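(* Let $\bm{C}\subset\mathbb{P}^3(\mathbb{R})$ be a rational algebraic curve properly parametrized by a homogeneous parametrization $\bm{p}$ of degree $n$ satisfying hypotheses (i)-(iv) listed in the context, and let $\varphi(t_0,t_1)=(at_0+bt_1,ct_0+dt_1)$ be a Möbius transformation with $a,b,c,d\in\mathbb{R}$, $ad-bc\neq0$. Then \begin{itemize} \item[i.] $\kappa_1(\bm{p}\circ\varphi)=\kappa_1(\bm{p})\circ\varphi$, \item[ii.] $\kappa_2(\bm{p}\circ\varphi)=\kappa_2(\bm{p})\circ\varphi$. \end{itemize}
   Context: A curve $\bm{C}\subset\mathbb{P}^3(\mathbb{R})$ is given by a homogeneous parametrization $\bm{p}:\mathbb{P}^1(\mathbb{R})\to\bm{C}$, $\bm{p}(t_0,t_1)=(p_0,p_1,p_2,p_3)$ (a column vector), whose components are real homogeneous polynomials of degree $n$ in $t_0,t_1$. Hypotheses: (i) $\bm{p}$ is proper, i.e. birational onto $\bm{C}$; (ii) $\gcd(p_0,p_1,p_2,p_3)=1$; (iii) the degree satisfies $n\ge4$; (iv) $\bm{C}$ is not contained in a hyperplane (so the $4\times(n+1)$ coefficient matrix of $\bm{p}$ has rank 4). Notation: $\bm{u}_{t_0^kt_1^l}=\partial^{k+l}\bm{u}/\partial t_0^k\partial t_1^l$; $\Vert\bm{w}_1\,\ldots\,\bm{w}_4\Vert$ is the determinant of the matrix with columns $\bm{w}_i$. Put $$\Delta(\bm{u})=\Vert \bm{u}_{t_0}\,\bm{u}_{t_1}\,\bm{u}_{t_0^2}\,\bm{u}_{t_0^3}\Vert,\quad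 A_1(\bm{u})=\Vert \bm{u}_{t_0^4}\,\bm{u}_{t_1}\,\bm{u}_{t_0^2}\,\bm{u}_{t_0^3}\Vert,\quad A_2(\bm{u})=\Vert \bm{u}_{t_0}\,\bm{u}_{t_0^4}\,\bm{u}_{t_0^2}\,\bm{u}_{t_0^3}\Vert,$$ $$A_3(\bm{u})=\Vert \bm{u}_{t_0}\,\bm{u}_{t_1}\,\bm{u}_{t_0^4}\,\bm{u}_{t_0^3}\Vert,\quad A_4(\bm{u})=\Vert \bm{u}_{t_0}\,\bm{u}_{t_1}\,\bm{u}_{t_0^2}\,\bm{u}_{t_0^4}\Vert,$$ $I_i(\bm{u})=A_i(\bm{u})/\Delta(\bm{u})$ for $i=1,2,3,4$, and $I_0(\bm{u})=t_1I_1(\bm{u})-t_0I_2(\bm{u})$. The projective curvatures are the rational functions of $(t_0,t_1)$ $$\kappa_1(\bm{u})=\frac{\left(8(n-3)^2I_0+4(n-1)(n-3)t_1I_3I_4+(n-1)(n-2)t_1I_4^3\right)^2}{t_1^2\left(8(n-3)I_3+3(n-2)I_4^2\right)^3},$$ $$\kappa_2(\bm{u})=\frac{256(n-3)^3I_2+64(n-3)^2I_0I_4+16(n-1)(n-3)t_1I_3I_4^2+3(n-1)(n-2)t_1I_4^4}{t_1\left(8(n-3)I_3+3(n-2)I_4^2\right)^2},$$ where $I_j=I_j(\bm{u})$. The equalities are identities of rational functions in $t_0,t_1$. *)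

(* Defs.v *)
(* Written with MathComp, multinomials and the realType of mathcomp-analysis. *)
From HB Require Import structures.
From mathcomp Require Import all_boot all_order all_algebra.
From mathcomp Require Import mpoly.
From mathcomp Require Import reals.

Set Implicit Arguments.
Unset Strict Implicit.
Unset Printing Implicit Defensive.

Import GRing.Theory.
Local Open Scope ring_scope.

(* A point of P^k(R) is represented by a nonzero column of k.+1 homogeneous
   coordinates. *)
Definition same_point (R : realType) (k : nat) (x y : 'cV[R]_k) : Prop :=
  exists2 c : R, c != 0 & x = c *: y.

Definition eval_at (R : realType) (k m : nat) (u : 'cV[{mpoly R[k]}]_m)
    (x : 'cV[R]_k) : 'cV[R]_m :=
  map_mx (meval (fun j => x j 0)) u.

(* The algebraic curve C of P^3(R) parametrized by p, i.e. the Zariski closure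
   of the image of p: the common zeros of all forms vanishing on that image. *)
Definition on_curve (R : realType) (p : 'cV[{mpoly R[2]}]_4)
    (x : 'cV[R]_4) : Prop :=
  x != 0 /\
  forall (e : nat) (F : {mpoly R[4]}), F \is e.-homog ->
    (forall t : 'cV[R]_2, F.@[fun i => eval_at p t i 0] = 0) ->
    F.@[fun i => x i 0] = 0.

Definition in_hyperplane (R : realType) (p : 'cV[{mpoly R[2]}]_4) : Prop :=
  exists2 a : 'rV[R]_4, a != 0 & forall x, on_curve p x -> a *m x = 0.

(* p is birational onto C: it has a rational inverse C --> P^1, given by two
   forms q of the same degree which do not both vanish identically on C. Both
   composites are the identity wherever they are defined by these forms. *)
Definition proper_param (R : realType) (p : 'cV[{mpoly R[2]}]_4) : Prop :=
  exists (m : nat) (q : 'cV[{mpoly R[4]}]_2),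
    [/\ forall j, q j 0 \is m.-homog,
        exists2 x, on_curve p x & eval_at q x != 0,
        forall t, t != 0 -> eval_at p t != 0 ->
          eval_at q (eval_at p t) != 0 ->
          same_point (eval_at q (eval_at p t)) t
      & forall x, on_curve p x -> eval_at q x != 0 ->
          eval_at p (eval_at q x) != 0 ->
          same_point (eval_at p (eval_at q x)) x].

(* gcd = 1: every common divisor is a unit. *)
Definition coprime_entries (R : realType) (p : 'cV[{mpoly R[2]}]_4) : Prop :=
  forall g : {mpoly R[2]},
    (forall i, exists h, p i 0 = g * h) -> g \is a GRing.unit.

Definition moebius (R : realType) (a b c d : R) : 2.-tuple {mpoly R[2]} :=
  [tuple a *: 'X_0 + b *: 'X_1; c *: 'X_0 + d *: 'X_1].

Definition param_comp (R : realType) (p : 'cV[{mpoly R[2]}]_4)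
    (phi : 2.-tuple {mpoly R[2]}) : 'cV[{mpoly R[2]}]_4 :=
  map_mx (comp_mpoly phi) p.

(* f o phi for a rational function f, by substitution in the numerator and the
   denominator of a representative; the choice does not matter when
   substituting phi is injective (ratfun_compE), as for an invertible moebius. *)
Definition ratfun_comp (R : realType) (f : {fraction {mpoly R[2]}})
    (phi : 2.-tuple {mpoly R[2]}) : {fraction {mpoly R[2]}} :=
  tofrac (\n_(repr f) \mPo phi) / tofrac (\d_(repr f) \mPo phi).

Lemma fracE (A : idomainType) (x : {fraction A}) :
  x = tofrac \n_(repr x) / tofrac \d_(repr x).
Proof.
have d0 : \d_(repr x) != 0 by exact: denom_ratioP.
apply: (canRL (mulfK _)); first by rewrite tofrac_eq0.
rewrite -{1}[x]reprK; unlock FracField.tofrac; rewrite -[LHS]FracField.pi_mul.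
apply/eqmodP; rewrite /= FracField.equivfE /FracField.mulf.
by rewrite !numden_Ratio ?mulr1 ?oner_neq0 // mulrC.
Qed.

Lemma ratfun_compE (R : realType) (phi : 2.-tuple {mpoly R[2]})
    (f g : {mpoly R[2]}) :
  injective (comp_mpoly phi) -> g != 0 ->
  ratfun_comp (tofrac f / tofrac g) phi
    = tofrac (f \mPo phi) / tofrac (g \mPo phi).
Proof.
move=> phi_inj g0; rewrite /ratfun_comp; set x := tofrac f / tofrac g.
have phi0 h : h != 0 -> tofrac (h \mPo phi) != 0.
  by rewrite tofrac_eq0 -[X in _ -> _ != X](comp_mpoly0 phi) (inj_eq phi_inj).
have d0 : \d_(repr x) != 0 by exact: denom_ratioP.
have /eqP eq_fg : f * \d_(repr x) == \n_(repr x) * g.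
  rewrite -tofrac_eq !rmorphM -eqr_div ?tofrac_eq0 //.
  by apply/eqP; exact: (fracE x).
apply/eqP; rewrite eq_sym eqr_div ?phi0 // -!rmorphM tofrac_eq.
by rewrite eq_fg.
Qed.

(* The degree n enters the curvatures as an explicit argument. Division is that
   of the field {fraction _}, with x / 0 = 0. *)
Section Curvatures.
Variables (R : realType) (n : nat) (u : 'cV[{mpoly R[2]}]_4).

(* the partial derivative of u, k times in t_0 and l times in t_1 *)
Definition du (k l : nat) : 'cV[{mpoly R[2]}]_4 :=
  map_mx (fun f => iter l (mderiv 1) (iter k (mderiv 0) f)) u.

Definition det4 (w1 w2 w3 w4 : 'cV[{mpoly R[2]}]_4) : {mpoly R[2]} :=
  \det (\matrix_(i < 4, j < 4) tnth [tuple w1; w2; w3; w4] j i 0).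

Definition Delta := det4 (du 1 0) (du 0 1) (du 2 0) (du 3 0).
Definition A1 := det4 (du 4 0) (du 0 1) (du 2 0) (du 3 0).
Definition A2 := det4 (du 1 0) (du 4 0) (du 2 0) (du 3 0).
Definition A3 := det4 (du 1 0) (du 0 1) (du 4 0) (du 3 0).
Definition A4 := det4 (du 1 0) (du 0 1) (du 2 0) (du 4 0).

Local Notation K := {fraction {mpoly R[2]}}.

Definition t0 : K := tofrac 'X_0.
Definition t1 : K := tofrac 'X_1.

Definition I1 : K := tofrac A1 / tofrac Delta.
Definition I2 : K := tofrac A2 / tofrac Delta.
Definition I3 : K := tofrac A3 / tofrac Delta.
Definition I4 : K := tofrac A4 / tofrac Delta.
Definition I0 : K := t1 * I1 - t0 * I2.

Local Notation N := (n%:R : K).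

Definition kappa1 : K :=
  (8 * (N - 3) ^+ 2 * I0 + 4 * (N - 1) * (N - 3) * t1 * I3 * I4
     + (N - 1) * (N - 2) * t1 * I4 ^+ 3) ^+ 2
  / (t1 ^+ 2 * (8 * (N - 3) * I3 + 3 * (N - 2) * I4 ^+ 2) ^+ 3).

Definition kappa2 : K :=
  (256 * (N - 3) ^+ 3 * I2 + 64 * (N - 3) ^+ 2 * I0 * I4
     + 16 * (N - 1) * (N - 3) * t1 * I3 * I4 ^+ 2
     + 3 * (N - 1) * (N - 2) * t1 * I4 ^+ 4)
  / (t1 * (8 * (N - 3) * I3 + 3 * (N - 2) * I4 ^+ 2) ^+ 2).

End Curvatures.

(* Main.v *)
Require Import Defs.
From HB Require Import structures.
From mathcomp Require Import all_boot all_order all_algebra.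
From mathcomp Require Import mpoly.
From mathcomp Require Import reals.
From mathcomp Require Import ring zify.

(** The curvatures are ratios of semi-invariants of a differential equation.

    Write [u'] for the derivative of [u] in [t_0]. By Cramer's rule the [I_i]
    are the coordinates of [u''''] in the frame [u_{t_0}, u_{t_1}, u'', u'''].
    Euler's identity [n u = t_0 u_{t_0} + t_1 u_{t_1}] lets one trade [u_{t_1}]
    for [u], and the coordinates become the coefficients of
      [u'''' = n q0 u + q1 u' + q2 u'' + q3 u'''],
    with [q0 = I_2 / t_1], [q1 = I_0 / t_1], [q2 = I_3], [q3 = I_4]
    ([kappa_equation]). All the factors [t_1] then cancel from the curvatures:
      [kappa_1 = weight3 ^ 2 / weight2 ^ 3], [kappa_2 = weight4 / weight2 ^ 2]
    for three polynomials [weight2], [weight3], [weight4] in the [q_i].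

    A Moebius transformation [phi] turns the derivation in [t_0] into
    [D = a d/dt_0 + c d/dt_1]. Euler's identity gives, on forms of degree [e],
      [D f = l f' + e m f],  [l = (a t_1 - c t_0) / t_1],  [m = c / t_1]
    ([tofrac_dir]). Since [D] commutes with [d/dt_0], the derivatives [D^k u]
    with [k <= 4] follow from this alone ([iter_new_deriv]), and solving for
    [D^4 u] gives the coefficients of the new equation ([new_equation]). The
    [weight_k] are built so that replacing the old coefficients by the new ones
    multiplies them by [l ^ k]: all terms containing [m] drop out. Hence
    both ratios are unchanged.

    It remains to compose with [phi]. As an invertible substitution it extends
    to a field endomorphism of the rational functions ([pullback]), which
    carries the equation satisfied by the [D^k p] to that of [p o phi].

    The equation determines its coefficients only where [Delta] does not
    vanish. Up to composition with [phi], passing from [p] to [p o phi]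
    multiplies [Delta] by [(ad - bc) l ^ 5] ([Delta_comp]), so it vanishes for
    both curves or for neither; when it does, [x / 0 = 0] makes all curvatures
    zero. *)

Set Implicit Arguments.
Unset Strict Implicit.
Unset Printing Implicit Defensive.

Import GRing.Theory.
Local Open Scope ring_scope.

(** * Differentiation and substitution of multivariate polynomials *)

Section Mpoly.
Variable R : comNzRingType.

Lemma comp_mpoly_comp n k l (s : n.-tuple {mpoly R[k]})
    (t : k.-tuple {mpoly R[l]}) (f : {mpoly R[n]}) :
  (f \mPo s) \mPo t = f \mPo [tuple tnth s i \mPo t | i < n].
Proof.
rewrite [f \mPo s]comp_mpolyE [RHS]comp_mpolyE raddf_sum /=.
apply: eq_bigr => m _; rewrite comp_mpolyZ rmorph_prod /=; congr (_ *: _).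
by apply: eq_bigr => i _; rewrite rmorphXn tnth_mktuple.
Qed.

(** The chain rule. Both sides are derivations along [comp_mpoly s], so the
    property is multiplicative and need only be checked on the variables. *)
Lemma mderiv_comp n k (s : n.-tuple {mpoly R[k]}) i (f : {mpoly R[n]}) :
  (f \mPo s)^`M(i) = \sum_(j < n) (f^`M(j) \mPo s) * (tnth s j)^`M(i).
Proof.
pose P g := (g \mPo s)^`M(i) = \sum_(j < n) (g^`M(j) \mPo s) * (tnth s j)^`M(i).
have P1 : P 1.
  rewrite /P comp_mpoly1 -mpolyC1 mderivC big1 // => j _.
  by rewrite mderivC comp_mpoly0 mul0r.
have PM g h : P g -> P h -> P (g * h).
  rewrite /P rmorphM /= mderivM => -> ->.
  rewrite mulr_suml mulr_sumr -big_split; apply: eq_bigr => j _ /=.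
  by rewrite mderivM rmorphD !rmorphM /=; ring.
have PX j : P 'X_j.
  rewrite /P comp_mpolyXU -tnth_nth (bigD1 j) //= big1 => [|l neq_lj].
    rewrite mderivX mnm1E eqxx scale1r.
    by rewrite -[X in (X - _)%MM]add0m addmK mpolyX0 comp_mpoly1 mul1r addr0.
  by rewrite mderivX mnm1E eq_sym (negbTE neq_lj) scale0r comp_mpoly0 mul0r.
elim/mpolyind: f => [|c m f _ _ IHf].
  by rewrite comp_mpoly0 mderiv0 big1 // => j _; rewrite mderiv0 comp_mpoly0 mul0r.
rewrite raddfD /= comp_mpolyZ mderivD mderivZ {}IHf.
have -> : ('X_[m] \mPo s)^`M(i)
    = \sum_(j < n) ('X_[m]^`M(j) \mPo s) * (tnth s j)^`M(i).
  rewrite -/(P _) mpolyXE_id; elim/big_ind: _ => // j _.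
  by elim: (m j) => [|e IHe]; rewrite ?expr0 // exprS; exact: PM.
rewrite scaler_sumr -big_split; apply: eq_bigr => j _ /=.
by rewrite mderivD mderivZ raddfD /= comp_mpolyZ mulrDl scalerAl.
Qed.

Lemma dhomog_mderiv n d i (f : {mpoly R[n]}) :
  f \is d.-homog -> f^`M(i) \is d.-1.-homog.
Proof.
move=> /dhomogP fd; apply/dhomogP => m; rewrite mcoeff_msupp mcoeff_mderiv => nz.
have : (m + U_(i))%MM \in msupp f.
  by rewrite mcoeff_msupp; apply: contraNneq nz => ->; rewrite mul0rn.
by move=> /fd /= <-; rewrite mdegD mdeg1 addn1.
Qed.

(** Euler's identity: each monomial is an eigenvector of the operator on the
    left, its degree being the eigenvalue. *)
Lemma euler_mpoly n d (f : {mpoly R[n]}) :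
  f \is d.-homog -> \sum_(i < n) 'X_i * f^`M(i) = d%:R * f.
Proof.
move=> fd; rewrite [f]mpolyE mulr_sumr.
under eq_bigr => i _ do rewrite raddf_sum mulr_sumr /=.
rewrite exchange_big /= big_seq [RHS]big_seq; apply: eq_bigr => m m_f.
rewrite -(dhomog_mf fd m_f) /= mdegE natr_sum mulr_suml; apply: eq_bigr => i _.
rewrite mderivZ mderivX -!scalerAr scalerA mulrC -scalerA.
have [-> | mi] := eqVneq (m i) 0%N; first by rewrite mul0r scale0r scaler0.
rewrite -mpolyXD addmC submK ?lep1mP // mulr_natl -scaler_nat.
by rewrite !scalerA mulrC.
Qed.

Lemma dhomog_comp_linear n k (s : n.-tuple {mpoly R[k]}) e f :
    (forall i, tnth s i \is 1.-homog) -> f \is e.-homog ->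
  f \mPo s \is e.-homog.
Proof.
move=> s1 fe; rewrite comp_mpolyE big_seq; apply: rpred_sum => m m_f.
apply: rpredZ; rewrite -(dhomog_mf fe m_f) /= mdegE.
elim/big_rec2: _ => [|i g r _ gr]; first exact: dhomog1.
by apply: dhomogM => //; rewrite -[X in X.-homog]mul1n; exact: dhomogMn.
Qed.

End Mpoly.

(** * Determinants *)

Section Cramer.
Variables (F : comNzRingType) (n : nat).

Definition replace_col (A : 'M[F]_n) (k : 'I_n) (w : 'cV[F]_n) : 'M[F]_n :=
  \matrix_(i, j) if j == k then w i 0 else A i j.

(** Cramer's rule without division: expanding along column [k], whose
    cofactors are those of [A], gives entry [k] of [\adj A *m (A *m x)]. *)
Lemma det_replace_col (A : 'M[F]_n) k (x : 'cV[F]_n) :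
  \det (replace_col A k (A *m x)) = x k 0 * \det A.
Proof.
have cof i : cofactor (replace_col A k (A *m x)) i k = \adj A k i.
  rewrite mxE /cofactor; congr (_ * \det _); apply/matrixP => r s.
  by rewrite !mxE eq_sym (negbTE (neq_lift _ _)).
rewrite (expand_det_col _ k).
transitivity ((\adj A *m (A *m x)) k 0).
  by rewrite [RHS]mxE; apply: eq_bigr => i _; rewrite cof mulrC [X in _ * X]mxE eqxx.
by rewrite mulmxA mul_adj_mx mul_scalar_mx mxE mulrC.
Qed.

End Cramer.

Lemma ord4P (P : 'I_4 -> Prop) : P 0 -> P 1 -> P 2 -> P 3 -> forall j, P j.
Proof.
move=> P0 P1 P2 P3 [[|[|[|[|//]]]] ltj].
- by rewrite (_ : Ordinal ltj = 0); last exact: val_inj.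
- by rewrite (_ : Ordinal ltj = 1); last exact: val_inj.
- by rewrite (_ : Ordinal ltj = 2); last exact: val_inj.
- by rewrite (_ : Ordinal ltj = 3); last exact: val_inj.
Qed.

Lemma sum_ord4 (V : nmodType) (h : 'I_4 -> V) :
  \sum_(j < 4) h j = h 0 + h 1 + h 2 + h 3.
Proof.
rewrite !big_ord_recr big_ord0 /= add0r.
by congr (h _ + h _ + h _ + h _); exact: val_inj.
Qed.

(** Stated on entries rather than on blocks, to be used on matrices given by
    their coefficients. *)
Lemma det_ublock4 (F : comNzRingType) (M : 'M[F]_4) :
    M 2 0 = 0 -> M 2 1 = 0 -> M 3 0 = 0 -> M 3 1 = 0 -> M 3 2 = 0 ->
  \det M = (M 0 0 * M 1 1 - M 0 1 * M 1 0) * (M 2 2 * M 3 3).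
Proof.
move=> z20 z21 z30 z31 z32.
have det2 (B : 'M[F]_2) : \det B = B 0 0 * B 1 1 - B 0 1 * B 1 0.
  rewrite (expand_det_row _ 0) big_ord_recl big_ord1 /cofactor !det_mx11 !mxE /=.
  rewrite expr0 mul1r expr1 mulN1r mulrN.
  by congr (B _ _ * B _ _ - B _ _ * B _ _); exact: val_inj.
pose B : 'M[F]_(2 + 2) := M.
have dl0 : dlsubmx B = 0.
  apply/matrixP => -[[|[|//]] lti] [[|[|//]] ltj]; rewrite !mxE.
  - by rewrite -[RHS]z20; congr (M _ _); exact: val_inj.
  - by rewrite -[RHS]z21; congr (M _ _); exact: val_inj.
  - by rewrite -[RHS]z30; congr (M _ _); exact: val_inj.
  - by rewrite -[RHS]z31; congr (M _ _); exact: val_inj.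
have -> : \det M = \det B by [].
rewrite -[B]submxK dl0 det_ublock !det2 !mxE.
rewrite [X in _ * (_ - _ * X)](_ : _ = 0) ?mulr0 ?subr0.
  by congr ((M _ _ * M _ _ - M _ _ * M _ _) * (M _ _ * M _ _)); exact: val_inj.
by rewrite -[RHS]z32; congr (M _ _); exact: val_inj.
Qed.

(** * Semi-invariants of a fourth-order equation *)

Section Weights.
Variables (F : comNzRingType) (N : F).

(** [weight_k] is isobaric of weight [k] when [q_i] has weight [4 - i]; for [N]
    the degree of the curve, these are the polynomials left in the curvatures
    once [t_1] is cancelled. *)
Definition weight2 (q2 q3 : F) := 8 * (N - 3) * q2 + 3 * (N - 2) * q3 ^+ 2.
Definition weight3 (q1 q2 q3 : F) :=
  8 * (N - 3) ^+ 2 * q1 + 4 * (N - 1) * (N - 3) * q2 * q3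
  + (N - 1) * (N - 2) * q3 ^+ 3.
Definition weight4 (q0 q1 q2 q3 : F) :=
  256 * (N - 3) ^+ 3 * q0 + 64 * (N - 3) ^+ 2 * q1 * q3
  + 16 * (N - 1) * (N - 3) * q2 * q3 ^+ 2
  + 3 * (N - 1) * (N - 2) * q3 ^+ 4.

Variables l m : F.

(** When [g j] is the [j]-th derivative in [t_0] of a form of degree [N], and
    [D] acts on forms of degree [e] as [l d/dt_0 + e m], the following are
    [D f], [D^2 f], [D^3 f] and [D^4 f]. *)
Definition new_deriv1 (g : nat -> F) := l * g 1 + N * m * g 0.
Definition new_deriv2 (g : nat -> F) :=
  l ^+ 2 * g 2 + 2 * (N - 1) * l * m * g 1 + N * (N - 1) * m ^+ 2 * g 0.
Definition new_deriv3 (g : nat -> F) :=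
  l ^+ 3 * g 3 + 3 * (N - 2) * l ^+ 2 * m * g 2
  + 3 * (N - 1) * (N - 2) * l * m ^+ 2 * g 1
  + N * (N - 1) * (N - 2) * m ^+ 3 * g 0.
Definition new_deriv4 (g : nat -> F) :=
  l ^+ 4 * g 4 + 4 * (N - 3) * l ^+ 3 * m * g 3
  + 6 * (N - 2) * (N - 3) * l ^+ 2 * m ^+ 2 * g 2
  + 4 * (N - 1) * (N - 2) * (N - 3) * l * m ^+ 3 * g 1
  + N * (N - 1) * (N - 2) * (N - 3) * m ^+ 4 * g 0.

(** Here [h k j] stands for [D^k] of the [j]-th derivative in [t_0] of the form,
    which has degree [N - j - k]; the hypothesis is the action of [D] on it,
    combined with the commutation of [D] and [d/dt_0]. *)
Lemma iter_new_deriv (h : nat -> nat -> F) :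
    (forall k j, (j + k < 4)%N ->
      h k.+1 j = l * h k j.+1 + (N - j%:R - k%:R) * m * h k j) ->
  [/\ h 1 0 = new_deriv1 (h 0), h 2 0 = new_deriv2 (h 0),
      h 3 0 = new_deriv3 (h 0) & h 4 0 = new_deriv4 (h 0)].
Proof.
move=> hS; split; rewrite !hS // /new_deriv1 /new_deriv2 /new_deriv3 /new_deriv4.
all: ring.
Qed.

Variables q0 q1 q2 q3 : F.

(** The coefficients of the equation satisfied by the [D^k f], obtained by
    triangular elimination from the highest derivative downwards. All powers of
    [l] in the denominators cancel, and [N] is a common factor of the terms in
    [g 0]: with [N] in front of [q0], the coefficients are polynomials. *)
Definition new_coef3 := l * q3 + 4 * (N - 3) * m.
Definition new_coef2 :=
  l ^+ 2 * q2 + 6 * (N - 2) * (N - 3) * m ^+ 2 - 3 * (N - 2) * m * new_coef3.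
Definition new_coef1 :=
  l ^+ 3 * q1 + 4 * (N - 1) * (N - 2) * (N - 3) * m ^+ 3
  - 2 * (N - 1) * m * new_coef2 - 3 * (N - 1) * (N - 2) * m ^+ 2 * new_coef3.
Definition new_coef0 :=
  l ^+ 4 * q0 + (N - 1) * (N - 2) * (N - 3) * m ^+ 4 - m * new_coef1
  - (N - 1) * m ^+ 2 * new_coef2 - (N - 1) * (N - 2) * m ^+ 3 * new_coef3.

Lemma new_equation (g : nat -> F) :
  g 4 = N * q0 * g 0 + q1 * g 1 + q2 * g 2 + q3 * g 3 ->
  new_deriv4 g = N * new_coef0 * g 0 + new_coef1 * new_deriv1 g
                 + new_coef2 * new_deriv2 g + new_coef3 * new_deriv3 g.
Proof.
rewrite /new_deriv4 => ->.
by rewrite /new_coef0 /new_coef1 /new_coef2 /new_coef3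
  /new_deriv1 /new_deriv2 /new_deriv3; ring.
Qed.

Lemma weight2_semiinvariant :
  weight2 new_coef2 new_coef3 = l ^+ 2 * weight2 q2 q3.
Proof. by rewrite /weight2 /new_coef2 /new_coef3; ring. Qed.

Lemma weight3_semiinvariant :
  weight3 new_coef1 new_coef2 new_coef3 = l ^+ 3 * weight3 q1 q2 q3.
Proof. by rewrite /weight3 /new_coef1 /new_coef2 /new_coef3; ring. Qed.

Lemma weight4_semiinvariant :
  weight4 new_coef0 new_coef1 new_coef2 new_coef3 = l ^+ 4 * weight4 q0 q1 q2 q3.
Proof. by rewrite /weight4 /new_coef0 /new_coef1 /new_coef2 /new_coef3; ring. Qed.

End Weights.

Lemma weight_ratios_semiinvariant (F : fieldType) n (q0 q1 q2 q3 m l : F)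
    (s3 := new_coef3 n%:R l m q3) (s2 := new_coef2 n%:R l m q2 q3)
    (s1 := new_coef1 n%:R l m q1 q2 q3) (s0 := new_coef0 n%:R l m q0 q1 q2 q3) :
    l != 0 ->
  weight3 n%:R s1 s2 s3 ^+ 2 / weight2 n%:R s2 s3 ^+ 3
    = weight3 n%:R q1 q2 q3 ^+ 2 / weight2 n%:R q2 q3 ^+ 3
  /\ weight4 n%:R s0 s1 s2 s3 / weight2 n%:R s2 s3 ^+ 2
    = weight4 n%:R q0 q1 q2 q3 / weight2 n%:R q2 q3 ^+ 2.
Proof.
move=> l0; rewrite weight2_semiinvariant weight3_semiinvariant weight4_semiinvariant.
have cancel k x y : (l ^+ k * x) / (l ^+ k * y) = x / y.
  by rewrite -mulf_div divff ?mul1r ?expf_neq0.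
split.
  by rewrite [(l ^+ 3 * _) ^+ 2]exprMn [(l ^+ 2 * _) ^+ 3]exprMn -!exprM cancel.
by rewrite [(l ^+ 2 * _) ^+ 2]exprMn -exprM cancel.
Qed.

Lemma rmorph_equation (F G : fieldType) (f : {rmorphism F -> G}) n
    (q0 q1 q2 q3 g0 g1 g2 g3 : F) :
  f (n%:R * q0 * g0 + q1 * g1 + q2 * g2 + q3 * g3)
  = n%:R * f q0 * f g0 + f q1 * f g1 + f q2 * f g2 + f q3 * f g3.
Proof. by rewrite !rmorphD !rmorphM rmorph_nat. Qed.

Lemma rmorph_weight_ratios (F G : fieldType) (f : {rmorphism F -> G}) n
    (q0 q1 q2 q3 : F) :
  f (weight3 n%:R q1 q2 q3 ^+ 2 / weight2 n%:R q2 q3 ^+ 3)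
    = weight3 n%:R (f q1) (f q2) (f q3) ^+ 2 / weight2 n%:R (f q2) (f q3) ^+ 3
  /\ f (weight4 n%:R q0 q1 q2 q3 / weight2 n%:R q2 q3 ^+ 2)
    = weight4 n%:R (f q0) (f q1) (f q2) (f q3) / weight2 n%:R (f q2) (f q3) ^+ 2.
Proof.
have w2 : f (weight2 n%:R q2 q3) = weight2 n%:R (f q2) (f q3).
  by rewrite /weight2; ring.
have w3 : f (weight3 n%:R q1 q2 q3) = weight3 n%:R (f q1) (f q2) (f q3).
  by rewrite /weight3; ring.
have w4 : f (weight4 n%:R q0 q1 q2 q3) = weight4 n%:R (f q0) (f q1) (f q2) (f q3).
  by rewrite /weight4; ring.
by split; rewrite fmorph_div !rmorphXn ?w2 ?w3 ?w4.
Qed.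

(** The left-hand sides are the defining formulas of the curvatures, with
    [I_0 = T q1] and [I_2 = T q0]. *)
Lemma curvature_weight_ratios (F : fieldType) (T N q0 q1 q2 q3 : F) : T != 0 ->
  (8 * (N - 3) ^+ 2 * (T * q1) + 4 * (N - 1) * (N - 3) * T * q2 * q3
     + (N - 1) * (N - 2) * T * q3 ^+ 3) ^+ 2
  / (T ^+ 2 * (8 * (N - 3) * q2 + 3 * (N - 2) * q3 ^+ 2) ^+ 3)
  = weight3 N q1 q2 q3 ^+ 2 / weight2 N q2 q3 ^+ 3
  /\ (256 * (N - 3) ^+ 3 * (T * q0) + 64 * (N - 3) ^+ 2 * (T * q1) * q3
     + 16 * (N - 1) * (N - 3) * T * q2 * q3 ^+ 2
     + 3 * (N - 1) * (N - 2) * T * q3 ^+ 4)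
  / (T * (8 * (N - 3) * q2 + 3 * (N - 2) * q3 ^+ 2) ^+ 2)
  = weight4 N q0 q1 q2 q3 / weight2 N q2 q3 ^+ 2.
Proof.
move=> T0; rewrite -/(weight2 N q2 q3).
split.
  rewrite [X in X ^+ 2 / _](_ : _ = T * weight3 N q1 q2 q3).
    by rewrite exprMn -mulf_div divff ?mul1r // expf_neq0.
  by rewrite /weight3; ring.
rewrite [X in X / _](_ : _ = T * weight4 N q0 q1 q2 q3).
  by rewrite -mulf_div divff ?mul1r.
by rewrite /weight4; ring.
Qed.

(** * Substitution in rational functions *)

Section Curves.
Variable R : realType.
Local Notation K := {fraction {mpoly R[2]}}.
Local Notation "f %:F" := (tofrac f : K).
Local Notation fracm := (map_mx (@tofrac {mpoly R[2]})).

Section Pullback.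
Variable phi : 2.-tuple {mpoly R[2]}.
Hypothesis phi_inj : injective (comp_mpoly phi).

(** The injectivity proof is an argument so that the ring morphism structure,
    which depends on it, can be inferred. *)
Definition pullback of injective (comp_mpoly phi) :=
  fun f : K => ratfun_comp f phi.
Local Notation Phi := (pullback phi_inj).

Lemma pullback_is_zmod_morphism : zmod_morphism Phi.
Proof.
move=> f g; rewrite /pullback [in LHS](fracE f) [in LHS](fracE g).
have nz (x : K) : \d_(repr x) != 0 by exact: denom_ratioP.
have nzc (x : K) : (\d_(repr x) \mPo phi)%:F != 0.
  by rewrite tofrac_eq0 -[X in _ != X](comp_mpoly0 phi) (inj_eq phi_inj) nz.
rewrite -mulNr addf_div ?tofrac_eq0 ?nz // -!(rmorphM, rmorphN, rmorphD) /=.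
rewrite ratfun_compE ?mulf_neq0 ?nz // /ratfun_comp -mulNr addf_div ?nzc //.
by rewrite !(rmorphM, rmorphN, rmorphD).
Qed.

Lemma pullback_is_monoid_morphism : monoid_morphism Phi.
Proof.
split=> [|f g]; rewrite /pullback.
  rewrite -[1 in LHS]divr1 -(rmorph1 (@tofrac _)) ratfun_compE ?oner_neq0 //.
  by rewrite comp_mpoly1 rmorph1 divr1.
rewrite [in LHS](fracE f) [in LHS](fracE g).
have nz (x : K) : \d_(repr x) != 0 by exact: denom_ratioP.
rewrite mulf_div -!rmorphM /= ratfun_compE ?mulf_neq0 ?nz //.
by rewrite /ratfun_comp mulf_div !rmorphM.
Qed.

HB.instance Definition _ :=
  GRing.isZmodMorphism.Build K K Phi pullback_is_zmod_morphism.
HB.instance Definition _ :=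
  GRing.isMonoidMorphism.Build K K Phi pullback_is_monoid_morphism.

Lemma pullback_tofrac f : Phi f%:F = (f \mPo phi)%:F.
Proof.
rewrite /pullback -[f%:F]divr1 -(rmorph1 (@tofrac _)) ratfun_compE ?oner_neq0 //.
by rewrite comp_mpoly1 rmorph1 divr1.
Qed.

End Pullback.

Lemma moebius_comp_inj (a b c d : R) :
  a * d - b * c != 0 -> injective (comp_mpoly (moebius a b c d)).
Proof.
set e := a * d - b * c => e0.
apply: (can_inj (g := comp_mpoly (moebius (d / e) (- b / e) (- c / e) (a / e)))).
have [h1 h2] : a * (d / e) + b * (- c / e) = 1 /\ a * (- b / e) + b * (a / e) = 0.
  by rewrite /e; split; field.
have [h3 h4] : c * (d / e) + d * (- c / e) = 0 /\ c * (- b / e) + d * (a / e) = 1.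
  by rewrite /e; split; field.
move=> f; rewrite comp_mpoly_comp -[RHS]comp_mpoly_id; congr (_ \mPo _).
apply: eq_mktuple => -[[|[|//]] lti]; rewrite (tnth_nth 0) /=;
  rewrite raddfD /= !comp_mpolyZ !comp_mpolyXU /= !scalerDr !scalerA addrACA;
  rewrite -!scalerDl ?h1 ?h2 ?h3 ?h4 scale1r scale0r ?addr0 ?add0r;
  by congr 'X_[U_(_)]; exact: val_inj.
Qed.

(** * Euler's identity and directional derivatives of binary forms *)

Lemma t1_neq0 : t1 R != 0.
Proof.
rewrite tofrac_eq0; apply/negP => /eqP /(congr1 (mcoeff U_(1))) /eqP.
by rewrite mcoeffX eqxx mcoeff0 oner_eq0.
Qed.

Lemma euler m f : f \is m.-homog ->
  m%:R * f%:F = t0 R * (f^`M(0 : 'I_2))%:F + t1 R * (f^`M(1 : 'I_2))%:F.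
Proof.
move=> /euler_mpoly /(congr1 (@tofrac _)).
have eq_last : lift ord0 ord0 = 1 :> 'I_2 by exact: val_inj.
by rewrite big_ord_recl big_ord1 eq_last rmorphD !rmorphM rmorph_nat => <-.
Qed.

Section Direction.
Variables a c : R.

Definition dir (f : {mpoly R[2]}) := a *: f^`M(0 : 'I_2) + c *: f^`M(1 : 'I_2).

Lemma mderiv_dir i f : (dir f)^`M(i) = dir f^`M(i).
Proof. by rewrite /dir mderivD !mderivZ !(mderiv_comm _ i). Qed.

Lemma dhomog_dir m f : f \is m.-homog -> dir f \is m.-1.-homog.
Proof. by move=> fm; apply: rpredD; apply: rpredZ; exact: dhomog_mderiv. Qed.

Definition const (x : R) : K := (x%:MP)%:F.
Definition slope : K := (const a * t1 R - const c * t0 R) / t1 R.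
Definition drift : K := const c / t1 R.

Lemma directional_euler (F : fieldType) (A C S T X Y : F) : T != 0 ->
  A * X + C * Y = (A * T - C * S) / T * X + (S * X + T * Y) * (C / T).
Proof. by move=> T0; field. Qed.

(** Euler's identity eliminates the derivative in [t_1]. *)
Lemma tofrac_dir m f : f \is m.-homog ->
  (dir f)%:F = slope * (f^`M(0 : 'I_2))%:F + m%:R * drift * f%:F.
Proof.
move=> /euler fm; rewrite /dir -!mul_mpolyC rmorphD !rmorphM /= -!/(const _).
rewrite [_ * drift * _]mulrAC fm /slope /drift.
by apply: directional_euler; exact: t1_neq0.
Qed.

Lemma divf_neq0 (F : fieldType) (x y : F) : x != 0 -> y != 0 -> x / y != 0.
Proof. by move=> x0 y0; rewrite mulf_neq0 ?invr_eq0. Qed.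

Lemma slope_neq0 : (a, c) != (0, 0) -> slope != 0.
Proof.
move=> ac0; apply: divf_neq0 t1_neq0; rewrite /const /t0 /t1.
rewrite -!rmorphM -rmorphB tofrac_eq0 /= !mul_mpolyC.
apply: contraNneq ac0 => E; apply/eqP.
(* The coefficients of a linear form are its values at the basis vectors. *)
have := congr1 (meval (fun i => (i == (0 : 'I_2))%:R)) E.
have := congr1 (meval (fun i => (i == (1 : 'I_2))%:R)) E.
rewrite !(mevalB, mevalZ, mevalXU, meval0) /= !(mulr0, mulr1, subr0, sub0r).
by move=> -> /eqP; rewrite oppr_eq0 => /eqP ->.
Qed.

Lemma tofrac_dirS m k f : f \is m.-homog -> (k <= m)%N ->
  (iter k.+1 dir f)%:F = slope * (iter k dir f^`M(0 : 'I_2))%:F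
    + (m - k)%:R * drift * (iter k dir f)%:F.
Proof.
move=> fm le_km; rewrite (@tofrac_dir (m - k)) /=.
  by congr (_ * _%:F + _); elim: k {le_km} => //= k IHk; rewrite mderiv_dir IHk.
elim: k le_km => [|k IHk] lt_km /=; first by rewrite subn0.
by rewrite subnS; apply: dhomog_dir; apply/IHk/ltnW.
Qed.

Lemma dhomog_dt0 m k (f : {mpoly R[2]}) :
  f \is m.-homog -> iter k (mderiv (0 : 'I_2)) f \is (m - k).-homog.
Proof.
move=> fm; elim: k => [|k IHk] /=; first by rewrite subn0.
by rewrite subnS; apply: dhomog_mderiv.
Qed.

Lemma tofrac_iter_dir n (f : {mpoly R[2]}) (N : K := n%:R)
    (g : nat -> K := fun k => (iter k (mderiv (0 : 'I_2)) f)%:F) :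
    f \is n.-homog -> (4 <= n)%N ->
  [/\ (iter 1 dir f)%:F = new_deriv1 N slope drift g,
      (iter 2 dir f)%:F = new_deriv2 N slope drift g,
      (iter 3 dir f)%:F = new_deriv3 N slope drift g
    & (iter 4 dir f)%:F = new_deriv4 N slope drift g].
Proof.
move=> fn le4n.
apply: (@iter_new_deriv _ N slope drift
  (fun k j => (iter k dir (iter j (mderiv (0 : 'I_2)) f))%:F)) => k j lt4.
have [le_jn le_kn] : (j <= n)%N /\ (k <= n - j)%N by lia.
by rewrite (tofrac_dirS (dhomog_dt0 j fn) le_kn) natrB // natrB.
Qed.

End Direction.

(** * Curvatures from the differential equation *)

Definition frame (u : 'cV[{mpoly R[2]}]_4) : 'M[{mpoly R[2]}]_4 :=
  \matrix_(i, j) tnth [tuple du u 1 0; du u 0 1; du u 2 0; du u 3 0] j i 0.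

Lemma det_frame_col (u : 'cV[{mpoly R[2]}]_4) :
  let w := du u 4 0 in
  [/\ A1 u = \det (replace_col (frame u) 0 w),
      A2 u = \det (replace_col (frame u) 1 w),
      A3 u = \det (replace_col (frame u) 2 w)
    & A4 u = \det (replace_col (frame u) 3 w)].
Proof.
by split; congr (\det _); apply/matrixP => i; apply: ord4P; rewrite !mxE.
Qed.

Lemma frame_coord u (x : 'cV[K]_4) : Delta u != 0 ->
    fracm (du u 4 0) = fracm (frame u) *m x ->
  [/\ I1 u = x 0 0, I2 u = x 1 0, I3 u = x 2 0 & I4 u = x 3 0].
Proof.
move=> D0 ux; have [E1 E2 E3 E4] := det_frame_col u.
have key k f : f = \det (replace_col (frame u) k (du u 4 0)) ->
    f%:F / (Delta u)%:F = x k 0.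
  move=> ->; rewrite -!det_map_mx.
  have -> : fracm (replace_col (frame u) k (du u 4 0))
      = replace_col (fracm (frame u)) k (fracm (du u 4 0)).
    by apply/matrixP => i j; rewrite !mxE; case: ifP.
  rewrite ux det_replace_col mulfK // det_map_mx tofrac_eq0.
  exact: D0.
split; [exact: key E1 | exact: key E2 | exact: key E3 | exact: key E4].
Qed.

Lemma frame_entries (u : 'cV[{mpoly R[2]}]_4) i
    (g : nat -> K := fun r => (iter r (mderiv 0) (u i 0))%:F) :
  [/\ fracm (frame u) i 0 = g 1, fracm (frame u) i 1 = ((u i 0)^`M(1))%:F,
      fracm (frame u) i 2 = g 2 & fracm (frame u) i 3 = g 3].
Proof. by split; rewrite !mxE. Qed.

Lemma frameE k (u : 'cV[{mpoly R[2]}]_4) (i : 'I_4) (x : 'M[K]_(4, k)) j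
    (g : nat -> K := fun r => (iter r (mderiv 0) (u i 0))%:F) :
  (fracm (frame u) *m x) i j
  = g 1 * x 0 j + ((u i 0)^`M(1))%:F * x 1 j + g 2 * x 2 j + g 3 * x 3 j.
Proof.
by have [f0 f1 f2 f3] := frame_entries u i; rewrite mxE sum_ord4 f0 f1 f2 f3.
Qed.

Lemma du_entry (u : 'cV[{mpoly R[2]}]_4) k (i : 'I_4) :
  fracm (du u k 0) i 0 = (iter k (mderiv 0) (u i 0))%:F.
Proof. by rewrite !mxE. Qed.

(** [u'''' = n q0 u + q1 u' + q2 u'' + q3 u'''], entry by entry. *)
Definition equation n (u : 'cV[{mpoly R[2]}]_4) (q0 q1 q2 q3 : K) :=
  forall i (g : nat -> K := fun k => (iter k (mderiv 0) (u i 0))%:F),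
  g 4 = n%:R * q0 * g 0 + q1 * g 1 + q2 * g 2 + q3 * g 3.

Lemma equation_of_coord (F : fieldType) (N S T h g0 g1 g2 g3 x0 x1 x2 x3 : F) :
  T != 0 -> N * g0 = S * g1 + T * h ->
  g1 * x0 + h * x1 + g2 * x2 + g3 * x3
    = N * (x1 / T) * g0 + (x0 - S * (x1 / T)) * g1 + x2 * g2 + x3 * g3.
Proof. by move=> T0 E; rewrite [N * _ * _]mulrAC E; field. Qed.

Lemma coord_of_equation (F : comNzRingType) (N S T h g0 g1 g2 g3 q0 q1 q2 q3 : F) :
  N * g0 = S * g1 + T * h ->
  N * q0 * g0 + q1 * g1 + q2 * g2 + q3 * g3
  = g1 * (q1 + S * q0) + h * (T * q0) + g2 * q2 + g3 * q3.
Proof. by move=> E; rewrite [N * _ * _]mulrAC E; ring. Qed.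

Lemma equation_exists n (u : 'cV[{mpoly R[2]}]_4) :
    (forall i, u i 0 \is n.-homog) -> Delta u != 0 ->
  exists q0 q1 q2 q3, equation n u q0 q1 q2 q3.
Proof.
move=> hom D0.
have unitF : fracm (frame u) \in unitmx.
  by rewrite unitmxE det_map_mx unitfE tofrac_eq0; exact: D0.
pose x := invmx (fracm (frame u)) *m fracm (du u 4 0).
exists (x 1 0 / t1 R), (x 0 0 - t0 R * (x 1 0 / t1 R)), (x 2 0), (x 3 0) => i g.
have E : fracm (du u 4 0) = fracm (frame u) *m x by rewrite mulKVmx.
rewrite /g -du_entry E frameE.
by apply: equation_of_coord t1_neq0 (euler (hom i)).
Qed.

(** Eliminating [u] by Euler's identity turns the equation into coordinates in
    the frame, which are unique, hence equal to the [I_i]. *)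
Lemma kappa_equation n (u : 'cV[{mpoly R[2]}]_4) q0 q1 q2 q3 (N : K := n%:R) :
  (forall i, u i 0 \is n.-homog) -> Delta u != 0 -> equation n u q0 q1 q2 q3 ->
  kappa1 n u = weight3 N q1 q2 q3 ^+ 2 / weight2 N q2 q3 ^+ 3
  /\ kappa2 n u = weight4 N q0 q1 q2 q3 / weight2 N q2 q3 ^+ 2.
Proof.
move=> hom D0 eqn.
pose x : 'cV[K]_4 := \col_j tnth [tuple q1 + t0 R * q0; t1 R * q0; q2; q3] j.
have ux : fracm (du u 4 0) = fracm (frame u) *m x.
  apply/colP => i; rewrite du_entry frameE (eqn i) !mxE /=.
  exact: (coord_of_equation _ _ q0 q1 q2 q3 (euler (hom i))).
have [E1 E2 E3 E4] := frame_coord D0 ux.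
have E0 : I0 u = t1 R * q1.
  rewrite /I0 E1 E2 !mxE /=.
  by rewrite mulrDr (mulrCA (t0 R)) addrK.
rewrite /kappa1 /kappa2 E0 E2 E3 E4 !mxE /=.
exact: (curvature_weight_ratios _ _ _ _ _ t1_neq0).
Qed.

Lemma kappa_degenerate n (u : 'cV[{mpoly R[2]}]_4) :
  Delta u = 0 -> kappa1 n u = 0 /\ kappa2 n u = 0.
Proof.
move=> D0.
have I_0 f : f%:F / (Delta u)%:F = 0 by rewrite D0 rmorph0 invr0 mulr0.
have E2 : I2 u = 0 by exact: I_0.
have E3 : I3 u = 0 by exact: I_0.
have E4 : I4 u = 0 by exact: I_0.
have E0 : I0 u = 0 by rewrite /I0 E2 /I1 I_0 !mulr0 subr0.
by split; rewrite /kappa1 /kappa2 E0 ?E2 E3 E4 !(expr0n, mulr0, mul0r, addr0).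
Qed.

(** * The effect of a Moebius transformation *)

(** The coordinates of [X u], [Y u], [X^2 u], [X^3 u] in the frame
    [u_{t_0}, u_{t_1}, u'', u'''], where [X = A d/dt_0 + C d/dt_1] and
    [Y = B d/dt_0 + D d/dt_1]. The terms in [S = t_0] and [T = t_1] come from
    replacing [N u] by [S u_{t_0} + T u_{t_1}]. *)
Definition frame_change (F : comNzRingType) (N S T l m A B C D : F) : 'M[F]_4 :=
  \matrix_(i, j) nth 0 (nth [::]
   [:: [:: A; B; 2 * (N - 1) * l * m + (N - 1) * m ^+ 2 * S;
          3 * (N - 1) * (N - 2) * l * m ^+ 2 + (N - 1) * (N - 2) * m ^+ 3 * S];
       [:: C; D; (N - 1) * m ^+ 2 * T; (N - 1) * (N - 2) * m ^+ 3 * T];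
       [:: 0; 0; l ^+ 2; 3 * (N - 2) * l ^+ 2 * m];
       [:: 0; 0; 0; l ^+ 3]] i) j.

Lemma det_frame_change (F : comNzRingType) (N S T l m A B C D : F) :
  \det (frame_change N S T l m A B C D) = (A * D - B * C) * l ^+ 5.
Proof. by rewrite det_ublock4 !mxE //= -exprD. Qed.

Lemma frame_changeE (F : comNzRingType) (N S T l m A B C D h : F) (g : nat -> F)
    (M := frame_change N S T l m A B C D)
    (e := fun j => g 1 * M 0 j + h * M 1 j + g 2 * M 2 j + g 3 * M 3 j) :
  N * g 0 = S * g 1 + T * h ->
  [/\ e 0 = A * g 1 + C * h, e 1 = B * g 1 + D * h,
      e 2 = new_deriv2 N l m g & e 3 = new_deriv3 N l m g].
Proof.
move=> E; rewrite /e !mxE /= /new_deriv2 /new_deriv3.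
split; [ring | ring | |].
  rewrite (_ : N * (N - 1) * m ^+ 2 * g 0 = (N - 1) * m ^+ 2 * (N * g 0)); last ring.
  by rewrite E; ring.
rewrite (_ : N * (N - 1) * (N - 2) * m ^+ 3 * g 0
  = (N - 1) * (N - 2) * m ^+ 3 * (N * g 0)); last ring.
by rewrite E; ring.
Qed.

Section Moebius.
Variables (n : nat) (p : 'cV[{mpoly R[2]}]_4) (a b c d : R).
Hypotheses (hom : forall i, p i 0 \is n.-homog) (le4n : (4 <= n)%N).
Hypothesis det0 : a * d - b * c != 0.
Local Notation phi := (moebius a b c d).
Local Notation v := (param_comp p phi).
Local Notation Phi := (pullback (moebius_comp_inj det0)).
Local Notation N := (n%:R : K).
Local Notation l := (slope a c).
Local Notation m := (drift c).

Lemma mderiv_moebius f :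
  (f \mPo phi)^`M(0) = dir a c f \mPo phi /\ (f \mPo phi)^`M(1) = dir b d f \mPo phi.
Proof.
have X (i j : 'I_2) : ('X_i : {mpoly R[2]})^`M(j) = (i == j)%:R.
  rewrite mderivX mnm1E; case: eqVneq => [->|]; last by rewrite scale0r.
  by rewrite scale1r -[X in (X - _)%MM]add0m addmK mpolyX0.
have chain j : (f \mPo phi)^`M(j)
    = (f^`M(0) \mPo phi) * (tnth phi 0)^`M(j) + (f^`M(1) \mPo phi) * (tnth phi 1)^`M(j).
  have eq_last : lift ord0 ord0 = 1 :> 'I_2 by exact: val_inj.
  by rewrite mderiv_comp big_ord_recl big_ord1 eq_last.
rewrite !chain /= !(tnth_nth 0) /= !mderivD !mderivZ !X /= /dir.
rewrite !raddfD /= !comp_mpolyZ !scaler0 !addr0 !add0r.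
by rewrite -!scalerAr !mulr1.
Qed.

Lemma dt0_comp k i :
  (iter k (mderiv 0) (v i 0))%:F = Phi ((iter k (dir a c) (p i 0))%:F).
Proof.
rewrite pullback_tofrac; congr tofrac; rewrite mxE.
by elim: k => //= k ->; rewrite (mderiv_moebius _).1.
Qed.

(** The [t_0]-derivatives of [p o phi] are the pullbacks of the [D^k p], which
    satisfy the transformed equation. *)
Lemma equation_comp q0 q1 q2 q3 : equation n p q0 q1 q2 q3 ->
  equation n v (Phi (new_coef0 N l m q0 q1 q2 q3)) (Phi (new_coef1 N l m q1 q2 q3))
    (Phi (new_coef2 N l m q2 q3)) (Phi (new_coef3 N l m q3)).
Proof.
move=> eqn i g; have [e1 e2 e3 e4] := tofrac_iter_dir a c (hom i) le4n.
have := new_equation l m (eqn i); rewrite -e4 -e3 -e2 -e1.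
move=> /(congr1 Phi) E.
rewrite /g (dt0_comp 4) (dt0_comp 3) (dt0_comp 2) (dt0_comp 1) (dt0_comp 0).
exact: etrans E (rmorph_equation _ _ _ _ _ _ _ _ _ _).
Qed.

(** Column operations: the frame of [p o phi] is the pullback of that of [p]
    times [frame_change]. *)
Lemma Delta_comp :
  (Delta v)%:F = Phi (const (a * d - b * c) * l ^+ 5 * (Delta p)%:F).
Proof.
pose M := frame_change N (t0 R) (t1 R) l m (const a) (const b) (const c) (const d).
have frame_v : fracm (frame v) = map_mx Phi (fracm (frame p) *m M).
  apply/matrixP => i j; rewrite [RHS]mxE frameE.
  have [e1 e2 e3 _] := tofrac_iter_dir a c (hom i) le4n.
  have [E0 E1 E2 E3] := @frame_changeE _ N (t0 R) (t1 R) l m (const a) (const b)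
    (const c) (const d) _ (fun r => (iter r (mderiv 0) (p i 0))%:F) (euler (hom i)).
  have dirE x y : (dir x y (p i 0))%:F = const x * ((p i 0)^`M(0))%:F
      + const y * ((p i 0)^`M(1))%:F.
    by rewrite /dir -!mul_mpolyC rmorphD !rmorphM.
  have v1 : ((v i 0)^`M(1))%:F = Phi ((dir b d (p i 0))%:F).
    by rewrite pullback_tofrac mxE (mderiv_moebius _).2.
  have [f0 f1 f2 f3] := frame_entries v i.
  elim/ord4P: j.
  - by rewrite f0 (dt0_comp 1); congr (Phi _); exact: etrans (dirE a c) (esym E0).
  - by rewrite f1 v1; congr (Phi _); exact: etrans (dirE b d) (esym E1).
  - by rewrite f2 (dt0_comp 2); congr (Phi _); exact: etrans e2 (esym E2).
  - by rewrite f3 (dt0_comp 3); congr (Phi _); exact: etrans e3 (esym E3).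
have det_frame u : (Delta u)%:F = \det (fracm (frame u)).
  exact: esym (det_map_mx _ _).
have constE : const a * const d - const b * const c = const (a * d - b * c).
  by rewrite /const mpolyCB !mpolyCM rmorphB !rmorphM.
rewrite det_frame frame_v; apply: etrans (det_map_mx _ _) _; congr (Phi _).
by rewrite det_mulmx det_frame_change constE det_frame mulrC.
Qed.

Lemma slope_moebius_neq0 : l != 0.
Proof.
apply: slope_neq0; apply: contraNneq det0 => -[-> ->].
by rewrite mul0r mulr0 subrr.
Qed.

Lemma Delta_comp_eq0 : (Delta v == 0) = (Delta p == 0).
Proof.
have c0 : const (a * d - b * c) != 0 by rewrite tofrac_eq0 mpolyC_eq0.
have cl0 := mulf_neq0 c0 (expf_neq0 5 slope_moebius_neq0).
rewrite -[in LHS](tofrac_eq0 (Delta v)) Delta_comp fmorph_eq0 mulf_eq0.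
by rewrite (negbTE cl0) tofrac_eq0.
Qed.

Lemma kappa_comp : kappa1 n v = Phi (kappa1 n p) /\ kappa2 n v = Phi (kappa2 n p).
Proof.
have homv i : v i 0 \is n.-homog.
  rewrite mxE; apply: dhomog_comp_linear (hom i) => j.
  rewrite (tnth_nth 0) /moebius.
  by case: j => [[|[|//]]] ltj; apply: rpredD; apply: rpredZ; rewrite dhomogX /= mdeg1.
have [D0 | D0] := eqVneq (Delta p) 0.
  have Dv0 : Delta v = 0 by apply/eqP; rewrite Delta_comp_eq0 D0.
  have [-> ->] := kappa_degenerate n D0; have [-> ->] := kappa_degenerate n Dv0.
  by rewrite rmorph0.
have Dv0 : Delta v != 0 by rewrite Delta_comp_eq0.
have [q0 [q1 [q2 [q3 eqn]]]] := equation_exists hom D0.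
have [-> ->] := kappa_equation hom D0 eqn.
have [-> ->] := kappa_equation homv Dv0 (equation_comp eqn).
have [<- <-] := weight_ratios_semiinvariant n q0 q1 q2 q3 m slope_moebius_neq0.
by have [-> ->] := rmorph_weight_ratios Phi n (new_coef0 N l m q0 q1 q2 q3)
  (new_coef1 N l m q1 q2 q3) (new_coef2 N l m q2 q3) (new_coef3 N l m q3).
Qed.

End Moebius.

End Curves.

Theorem lemma9 (R : realType) (n : nat) (p : 'cV[{mpoly R[2]}]_4)
    (hhom : forall i, p i 0 \is n.-homog)
    (hproper : proper_param p)
    (hgcd : coprime_entries p)
    (hn : (4 <= n)%N)
    (hplane : ~ in_hyperplane p)
    (a b c d : R) (hdet : a * d - b * c != 0) :
  kappa1 n (param_comp p (moebius a b c d))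
    = ratfun_comp (kappa1 n p) (moebius a b c d)
  /\ kappa2 n (param_comp p (moebius a b c d))
    = ratfun_comp (kappa2 n p) (moebius a b c d).
Proof. exact: (kappa_comp hhom hn hdet). Qed.
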